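(* Let $\mathcal{A}$ be an elation KM-arc of type $t$ in $\mathrm{PG}(2,q)$, $2\leq t<q$, with elation line $m$. Then $m$ is a $t$-secant to $\mathcal{A}$.
   Context: A KM-arc of type $t$ in $\mathrm{PG}(2,q)$ is a set of $q+t$ points such that every line meets it in $0$, $2$ or $t$ points (each value occurring); a line meeting it in $i$ points is an $i$-secant. A hyperoval is a KM-arc of type $2$. It is known that if $2<t<q$, then $q$ is even, $t\mid q$, and there are exactly $q/t+1$ $t$-secants, all passing through one common point, the $t$-nucleus. An elation with axis a line $\ell$ and centre a point $R\in\ell$ is a collineation fixing all points of $\ell$ and stabilising all lines through $R$ (the identity is included). A KM-arc $\mathcal{A}$ of type $t>2$ is an elation KM-arc with elation line $\ell_\infty$ if for every $t$-secant $\ell\neq\ell_\infty$ the group of elations with axis $\ell_\infty$ stabilising $\mathcal{A}$ is transitive on the points of $\mathcal{A}\cap\ell$ (any point of $\mathcal{A}\cap\ell$ can be mapped to any other one by an element of the group). A hyperoval (KM-arc of type $2$) is an elation KM-arc (elation hyperoval) with elation line $\ell_\infty$ if it is stabilised by a non-trivial elation with axis $\ell_\infty$. *)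

(* Defs.v *)
From HB Require Import structures.
From mathcomp Require Import all_boot all_order all_fingroup all_algebra.

Set Implicit Arguments.
Unset Strict Implicit.
Unset Printing Implicit Defensive.

Import VectorInternalTheory.

HB.instance Definition _ (F : finFieldType) (vT : vectType F) :=
  [Countable of {vspace vT} by <:].
HB.instance Definition _ (F : finFieldType) (vT : vectType F) :=
  [Finite of {vspace vT} by <:].

(* PG(2,q), with q = #|F|: the points and lines are the subspaces of F^3 of
   vector dimension 1 and 2. *)
Definition point (F : finFieldType) : finType :=
  {U : {vspace 'rV[F]_3} | \dim U == 1%N}.
Definition line (F : finFieldType) : finType :=
  {U : {vspace 'rV[F]_3} | \dim U == 2%N}.

Section PG2.
Variable F : finFieldType.
Implicit Types (A : {set point F}) (P Q R : point F) (l m : line F).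
Implicit Types (g : {perm point F}) (t i : nat).

Definition points_on l : {set point F} := [set P | (val P <= val l)%VS].

Definition secant A i l : bool := #|A :&: points_on l| == i.

Definition KM_arc t A : Prop :=
  [/\ #|A| = (#|F| + t)%N,
      forall l, [|| secant A 0 l, secant A 2 l | secant A t l]
    & forall i, i \in [:: 0; 2; t] -> exists l, secant A i l].

(* Mapping each line onto a line suffices for a permutation of a finite plane:
   the induced injective map on lines is then a bijection. *)
Definition collineation g : bool :=
  [forall l, exists l', g @: points_on l == points_on l'].

Definition elation_with_centre l R g : bool :=
  [&& R \in points_on l, collineation g,
      [forall P in points_on l, g P == P]
    & [forall l', (R \in points_on l') ==>
         (g @: points_on l' == points_on l')]].

(* The centre may vary along the axis. *)
Definition elations l : {set {perm point F}} :=
  [set g | [exists R, elation_with_centre l R g]].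

Definition elation_stab l A : {set {perm point F}} :=
  [set g in elations l | g @: A == A].

Definition elation_KM_arc t A m : Prop :=
  KM_arc t A /\
  (   (t = 2 /\ exists2 g, g \in elation_stab m A & g != 1%g)
   \/ (2 < t /\
       forall l, secant A t l -> l != m ->
       forall P Q, P \in A :&: points_on l -> Q \in A :&: points_on l ->
       exists2 g, g \in elation_stab m A & g P = Q)).

End PG2.

(* Main.v *)
(** Suppose the axis [m] is not a [t]-secant; then it misses the arc [A]. Let [H]
    be the group of elations with axis [m] and a fixed centre [R] stabilising
    [A], where [R] is on a [t]-secant (or is the centre of the given elation, if
    [t = 2]). A non-trivial element of [H] fixes no point off [m], so [H] has
    order [t]: it is regular on the arc points of that [t]-secant (or, if
    [t = 2], its order divides both [q] and [q + 2]). Nor does it fix a line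
    other than [m] through a point [S <> R] of [m]. So [t] divides the number [a]
    of [t]-secants and the number [b] of lines meeting [A] through [S]. Counting
    [A] along these lines, [(t - 2) a + 2 b = q + t], and as [t] is even, [2 t]
    divides [q + t]. But [t] and [q > t] are powers of two, so [2 t] divides [q],
    a contradiction. *)

Require Import Defs.
From HB Require Import structures.
From mathcomp Require Import all_boot all_order all_fingroup all_algebra.
From mathcomp Require Import finfield zify.

Set Implicit Arguments.
Unset Strict Implicit.
Unset Printing Implicit Defensive.

Import GRing.Theory.

(** * Incidence and counting in the projective plane *)

Section Incidence.
Variable F : finFieldType.
Implicit Types (A X : {set point F}) (P Q R S : point F) (l m : line F).

Lemma card_field_gt1 : 1 < #|F|. Proof. exact: (card_finRing_gt1 F). Qed.

Definition point_of (U : {vspace 'rV[F]_3}) (dU : \dim U == 1) : point F :=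
  exist (fun V : {vspace 'rV[F]_3} => \dim V == 1) U dU.
Definition line_of (U : {vspace 'rV[F]_3}) (dU : \dim U == 2) : line F :=
  exist (fun V : {vspace 'rV[F]_3} => \dim V == 2) U dU.

Lemma dim_point P : \dim (val P) = 1. Proof. exact/eqP/(valP P). Qed.
Lemma dim_line l : \dim (val l) = 2. Proof. exact/eqP/(valP l). Qed.

Lemma dim_rV3 (U : {vspace 'rV[F]_3}) : \dim U <= 3.
Proof. by apply: leq_trans (dimvS (subvf U)) _; rewrite dimvf dim_matrix. Qed.

Lemma dim_join P Q : P != Q -> \dim (val P + val Q)%VS = 2.
Proof.
move=> neqPQ; have := dimv_sum_cap (val P) (val Q).
have := dimvS (capvSl (val P) (val Q)); rewrite !dim_point.
(* The intersection has dimension 0, as needed, or 1, and then it equals both points. *)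
case: (\dim (_ :&: _)) (eqEdim (val P :&: val Q)%VS (val P))
  => [|[|//]]; first lia.
rewrite capvSl dim_point leqnn => /eqP capP _.
case/eqP: neqPQ; apply/val_inj/eqP.
by rewrite eqEdim !dim_point leqnn andbT -capP capvSr.
Qed.

Lemma join_exists P Q : P != Q ->
  exists2 l, P \in points_on l & Q \in points_on l.
Proof.
move=> /dim_join/eqP dPQ; exists (line_of dPQ).
  by rewrite inE addvSl.
by rewrite inE addvSr.
Qed.

Lemma join_unique P Q l m : P != Q ->
  P \in points_on l -> Q \in points_on l ->
  P \in points_on m -> Q \in points_on m -> l = m.
Proof.
move=> neqPQ; rewrite !inE => Pl Ql Pm Qm; apply: val_inj.
suff join (n : line F) : (val P <= val n)%VS -> (val Q <= val n)%VS ->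
    (val P + val Q)%VS = val n by rewrite -(join l) // -(join m).
by move=> Pn Qn; apply/eqP; rewrite eqEdim dim_join // dim_line subv_add Pn Qn.
Qed.

(** Two 2-dimensional subspaces of a 3-dimensional space share a non-zero vector. *)
Lemma meet_exists l m : exists2 P, P \in points_on l & P \in points_on m.
Proof.
pose v := vpick (val l :&: val m)%VS.
have v0 : v != 0%R.
  rewrite vpick0 -dimv_eq0; have := dimv_sum_cap (val l) (val m).
  by rewrite !dim_line; have := dim_rV3 (val l + val m)%VS; lia.
have dv : \dim <[v]>%VS == 1 by rewrite dim_vline v0.
have : (<[v]> <= val l :&: val m)%VS by rewrite -memvE memv_pick.
by rewrite subv_cap => /andP[vl vm]; exists (point_of dv); rewrite inE.
Qed.

Lemma meet_unique P Q l m : l != m ->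
  P \in points_on l -> P \in points_on m ->
  Q \in points_on l -> Q \in points_on m -> P = Q.
Proof.
move=> neqlm Pl Pm Ql Qm; apply/eqP; apply: contraNT neqlm => neqPQ.
exact/eqP/(@join_unique P Q).
Qed.

Lemma missing_line P : exists l, P \notin points_on l.
Proof.
have dC : \dim (val P)^C%VS == 2.
  by rewrite dimv_compl dimvf dim_matrix dim_point.
exists (line_of dC); rewrite inE /=; apply/negP => /capv_idPl.
by rewrite capv_compl => P0; have := dim_point P; rewrite -[val P]P0 dimv0.
Qed.

Lemma missing_point l : exists P, P \notin points_on l.
Proof.
pose v := vpick (val l)^C%VS.
have dv : \dim <[v]>%VS == 1.
  rewrite dim_vline vpick0 -dimv_eq0 dimv_compl dimvf dim_matrix.
  by rewrite [\dim _]dim_line.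
exists (point_of dv); rewrite inE /=; apply/negP => vl.
have: (<[v]> <= val l :&: (val l)^C)%VS by rewrite subv_cap vl -memvE memv_pick.
by rewrite capv_compl => /dimvS; rewrite (eqP dv) dimv0.
Qed.

Lemma point_span P : exists2 v, v != 0%R & val P = <[v]>%VS.
Proof.
pose v := vpick (val P).
have v0 : v != 0%R by rewrite vpick0 -dimv_eq0 dim_point.
exists v => //; apply/esym/eqP.
by rewrite eqEdim dim_vline v0 dim_point -memvE memv_pick.
Qed.

Lemma line_basis l : exists u v : 'rV[F]_3,
  [/\ u != 0%R, v \notin <[u]>%VS & val l = (<[u]> + <[v]>)%VS].
Proof.
pose u := vpick (val l).
have u0 : u != 0%R by rewrite vpick0 -dimv_eq0 dim_line.
have ul : u \in val l by exact: memv_pick.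
have /subvPn[v vl vu] : ~~ (val l <= <[u]>)%VS.
  by apply/negP => /dimvS; rewrite dim_line dim_vline u0.
have v0 : v != 0%R by apply: contraNneq vu => ->; rewrite mem0v.
exists u, v; split=> //; apply/esym/eqP.
rewrite eqEdim subv_add -!memvE ul vl dim_line.
rewrite dimv_disjoint_sum ?dim_vline ?u0 ?v0 //.
apply/eqP; rewrite -subv0; apply/subvP => w; rewrite memv_cap.
case/andP=> wu /vlineP[k wE]; move: wu; rewrite {}wE memv0.
have [->|k0] := eqVneq k 0%R; first by rewrite scale0r.
by move/(memvZ k^-1); rewrite scalerK // (negPf vu).
Qed.

(** With [u], [v] a basis, the points are [<[u]>] and the [<[v + a *: u]>], one for each scalar [a];
    [option F] indexes them. *)
Lemma card_points_on l : #|points_on l| = #|F|.+1.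
Proof.
have [u [v [u0 vu lE]]] := line_basis l.
pose w (c : option F) : 'rV[F]_3 := if c is Some a then (v + a *: u)%R else u.
have w0 c : w c != 0%R.
  case: c => [a|] //=; apply: contraNneq vu => /eqP.
  by rewrite addr_eq0 => /eqP ->; rewrite memvN memvZ ?memv_line.
have dw c : \dim <[w c]>%VS == 1 by rewrite dim_vline w0.
pose f c : point F := point_of (dw c).
have f_inj : injective f.
  move=> c d /(congr1 val)/= E.
  have: w c \in <[w d]>%VS by rewrite -E memv_line.
  case/vlineP => k; case: c d {E} => [a|] [b|] //= E.
  (* Comparing coefficients: [(k - 1) *: v] is a multiple of [u], so [k = 1], and then [a = b]. *)
  - have /eqP k1 : k == 1%R.
      rewrite -subr_eq0; apply: contraNT vu => k1.
      have : ((k - 1) *: v)%R = ((a - k * b) *: u)%R.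
        apply/eqP; rewrite !scalerBl scale1r -scalerA subr_eq addrAC.
        by rewrite eq_sym subr_eq addrC E scalerDr.
      by move=> E'; rewrite -(scalerK k1 v) E' !memvZ ?memv_line.
    move: E; rewrite k1 scale1r => /addrI/eqP.
    by rewrite -subr_eq0 -scalerBl scaler_eq0 (negPf u0) orbF subr_eq0 => /eqP->.
  - case/negP: vu; have -> : v = (k *: u - a *: u)%R by rewrite -E addrK.
    by rewrite memvB // memvZ ?memv_line.
  - have k0 : k != 0%R by apply: contraNneq u0 => k0; rewrite E k0 scale0r.
    case/negP: vu; have -> : v = (k^-1 *: u - b *: u)%R.
      by rewrite {1}E scalerK // addrK.
    by rewrite memvB // memvZ ?memv_line.
suff -> : points_on l = f @: setT by rewrite card_imset // cardsT card_option.
apply/setP=> P; rewrite inE; apply/idP/imsetP => [|[c _ ->]]; last first.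
  rewrite /= lE -memvE; case: c => [a|] /=.
    by rewrite addrC memv_add ?memvZ ?memv_line.
  exact: (subvP (addvSl _ _)) (memv_line _).
have [x x0 PE] := point_span P; rewrite PE lE -memvE.
case/memv_addP => _ /vlineP[a ->] [_ /vlineP[b ->] xE].
have span c k : k != 0%R -> x = (k *: w c)%R -> P = f c.
  move=> k0 E; apply/val_inj/eqP; rewrite /= PE E eqEdim !dim_vline w0.
  by rewrite scaler_eq0 (negPf k0) w0 andbT -memvE memvZ ?memv_line.
have [b0|b0] := eqVneq b 0%R.
  move: xE; rewrite b0 scale0r addr0 => xE.
  exists None => //; apply: (span _ a) => //.
  by apply: contraNneq x0 => a0; rewrite xE a0 scale0r.
(* Dividing [x = a *: u + b *: v] by [b] gives [v + (b^-1 * a) *: u]. *)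
exists (Some (b^-1 * a)%R) => //; apply: (span _ b) => //=.
by rewrite scalerDr scalerA mulrA divff // mul1r addrC.
Qed.

Definition pencil P : {set line F} := [set l | P \in points_on l].

Lemma card_join P Q : P != Q -> #|[set l in pencil P | Q \in points_on l]| = 1.
Proof.
move=> neqPQ; have [l Pl Ql] := join_exists neqPQ.
apply/eqP/cards1P; exists l; apply/setP=> m.
rewrite !in_set1 in_set (in_set (fun l => _)).
apply/andP/eqP => [[Pm Qm]|->//]; exact: (join_unique neqPQ).
Qed.

(** Double counting: since [P] is not in [X], each point of [X] is on exactly one line through
    [P]. *)
Lemma sum_pencil P X : P \notin X ->
  \sum_(l in pencil P) #|X :&: points_on l| = #|X|.
Proof.
move=> PX; rewrite -sum1_card.
have -> : \sum_(l in pencil P) #|X :&: points_on l| =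
    \sum_(l in pencil P) \sum_(Q in X | Q \in points_on l) 1.
  apply: eq_bigr => l _; rewrite sum1_card; apply: eq_card => Q.
  by rewrite inE [RHS]unfold_in.
rewrite (exchange_big_dep (mem X)) /=; last by move=> ? ? _ /andP[].
apply: eq_bigr => Q QX.
have neqPQ : P != Q by apply: contraNneq PX => ->.
rewrite -[RHS](card_join neqPQ) sum1_card; apply: eq_card => l.
by rewrite [RHS]in_set unfold_in QX.
Qed.

Lemma card_meet l m : l != m -> #|points_on l :&: points_on m| = 1.
Proof.
move=> neqlm; have [P Pl Pm] := meet_exists l m.
apply/eqP/cards1P; exists P; apply/setP=> Q; rewrite in_setI in_set1.
apply/andP/eqP => [[Ql Qm]|->//]; exact: (meet_unique neqlm).
Qed.

(** Each line through [P] meets a fixed line missing [P] in one point, so the pencil has as many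
    lines as that line has points. *)
Lemma card_pencil P : #|pencil P| = #|F|.+1.
Proof.
have [l Pl] := missing_line P; rewrite -(card_points_on l) -(sum_pencil Pl).
rewrite -sum1_card; apply: eq_bigr => m; rewrite in_set => Pm.
by rewrite card_meet //; apply: contraNneq Pl => ->.
Qed.

(** Allows lines to be counted as point sets, on which permutations of the points act. *)
Lemma points_on_inj : injective (@points_on F).
Proof.
move=> l m E; apply/eqP/negPn/negP => /card_meet.
rewrite E setIid card_points_on => -[F0].
by have := card_field_gt1; rewrite F0.
Qed.

End Incidence.

(** * Fixed points and fixed lines of elations *)

Section Elations.
Variable F : finFieldType.
Implicit Types (A X : {set point F}) (P Q R S : point F) (l m : line F).
Implicit Types (g h : {perm point F}).

Lemma elation_with_centreP m R g :
  reflect [/\ R \in points_on m,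
              forall l, exists l', g @: points_on l = points_on l',
              {in points_on m, g =1 id}
            & forall l, R \in points_on l -> g @: points_on l = points_on l]
          (elation_with_centre m R g).
Proof.
apply: (iffP and4P) => -[Rm coll fixm fixR].
  split=> // [l|P Pm|l Rl].
  - by have /existsP[l' /eqP ->] := forallP coll l; exists l'.
  - exact/eqP/(forall_inP fixm).
  - exact/eqP/(implyP (forallP fixR l)).
split=> //.
- by apply/forallP => l; have [l' ->] := coll l; apply/existsP; exists l'.
- by apply/forall_inP => P /fixm ->.
- by apply/forallP => l; apply/implyP => /fixR ->.
Qed.

(* A line through a fixed point off the axis meets the axis in a second fixed
   point, so it is fixed; off the line joining P to the centre this pins down
   each Q as the intersection of the fixed lines QP and QR. *)
Lemma elation_fix_off_join m R g P Q l : elation_with_centre m R g ->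
  P \notin points_on m -> g P = P -> R \in points_on l -> P \in points_on l ->
  Q \notin points_on l -> g Q = Q.
Proof.
case/elation_with_centreP=> Rm coll fixm fixR Pm gP Rl Pl Ql.
have neqQP : Q != P by apply: contraNneq Ql => ->.
have neqQR : Q != R by apply: contraNneq Ql => ->.
have [k Qk Pk] := join_exists neqQP; have [n Qn Rn] := join_exists neqQR.
have [S Sm Sk] := meet_exists m k; have [k' kE] := coll k.
have Pk' : P \in points_on k' by rewrite -kE -gP imset_f.
have Sk' : S \in points_on k' by rewrite -kE -(fixm S Sm) imset_f.
have neqPS : P != S by apply: contraNneq Pm => ->.
have eqk : k' = k by apply: (join_unique neqPS).
apply: (@meet_unique _ _ _ n k) => //.
- apply: contraNneq Ql => nk; suff -> : l = n by [].
  have neqPR : P != R by apply: contraNneq Pm => ->.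
  by apply: (join_unique neqPR) => //; rewrite nk.
- by rewrite -(fixR n Rn) imset_f.
- by rewrite -eqk -kE imset_f.
Qed.

(** If the lines differ, join a point of [l] alone to a point of [m] alone: a third point of the
    join lies on neither, and there is one because lines have at least 3 points. *)
Lemma off_two_lines l m :
  exists2 P, P \notin points_on l & P \notin points_on m.
Proof.
have [->|neqlm] := eqVneq l m; first by have [P Pm] := missing_point m; exists P.
have [P Pl Pm] : exists2 P, P \in points_on l & P \notin points_on m.
  apply/subsetPn/negP => /setIidPl lm; have := card_meet neqlm.
  by rewrite lm card_points_on; have := card_field_gt1 F; lia.
have [Q Qm Ql] : exists2 Q, Q \in points_on m & Q \notin points_on l.
  apply/subsetPn/negP => /setIidPr lm; have := card_meet neqlm.
  by rewrite lm card_points_on; have := card_field_gt1 F; lia.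
have neqPQ : P != Q by apply: contraNneq Pm => ->.
have [k Pk Qk] := join_exists neqPQ.
have /subsetPn[S Sk] : ~~ (points_on k \subset [set P; Q]).
  apply/negP => /subset_leq_card; rewrite card_points_on cards2 neqPQ.
  by have := card_field_gt1 F; lia.
rewrite !inE negb_or => /andP[neqSP neqSQ]; exists S.
  apply: contraNN Ql => Sl; suff -> : l = k by [].
  exact: (join_unique neqSP).
apply: contraNN Pm => Sm; suff -> : m = k by [].
exact: (join_unique neqSQ).
Qed.

(** Points off the line [l] joining [P] to the centre are fixed already. One of them, [P'], off the
    axis, takes over the role of [P] for the points of [l]. *)
Lemma elation_fix_off_axis m R g P : elation_with_centre m R g ->
  P \notin points_on m -> g P = P -> g = 1%g.
Proof.
move=> el Pm gP; apply/permP => Q; rewrite perm1.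
have /elation_with_centreP[Rm _ fixm _] := el.
have neqPR : P != R by apply: contraNneq Pm => ->.
have [l Pl Rl] := join_exists neqPR.
have [Ql|] := boolP (Q \in points_on l);
  last exact: (elation_fix_off_join el Pm gP Rl Pl).
have [P' P'l P'm] := off_two_lines l m.
have gP' : g P' = P' by apply: (elation_fix_off_join el Pm gP Rl Pl).
have neqP'R : P' != R by apply: contraNneq P'm => ->.
have [l' P'l' Rl'] := join_exists neqP'R.
have [->|neqQR] := eqVneq Q R; first exact: fixm.
apply: (elation_fix_off_join el P'm gP' Rl' P'l').
apply: contraNN P'l => Ql'; suff -> : l = l' by [].
exact: (join_unique neqQR).
Qed.

(** A point [P] of [l] off the axis is the intersection of [l] and [PR], both stabilised, so it is
    fixed. *)
Lemma elation_fix_line m R g S l : elation_with_centre m R g ->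
  S \in points_on m -> S != R -> S \in points_on l -> l != m ->
  g @: points_on l = points_on l -> g = 1%g.
Proof.
move=> el Sm neqSR Sl neqlm gl.
have /elation_with_centreP[Rm _ fixm fixR] := el.
have /subsetPn[P Pl PS] : ~~ (points_on l \subset [set S]).
  apply/negP => /subset_leq_card; rewrite card_points_on cards1.
  by have := card_field_gt1 F; lia.
rewrite in_set1 in PS.
have Pm : P \notin points_on m.
  by apply: contraNN neqlm => Pm; apply/eqP/(join_unique PS).
have neqPR : P != R by apply: contraNneq Pm => ->.
have [k Pk Rk] := join_exists neqPR.
apply: (elation_fix_off_axis el Pm); apply: (@meet_unique _ _ _ k l) => //.
- apply: contraNneq neqlm => kl; apply/eqP/(join_unique neqSR) => //.
  by rewrite -kl.
- by rewrite -(fixR k Rk) imset_f.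
- by rewrite -gl imset_f.
Qed.

(** The centre is prescribed here, so closure under products is immediate; in [elation_stab] a
    product may have a new centre. *)
Definition central_stab m R A : {set {perm point F}} :=
  [set g | elation_with_centre m R g & g @: A == A].

Lemma imset_permM g h X : (g * h)%g @: X = h @: (g @: X).
Proof. by rewrite -imset_comp; apply: eq_imset => P; rewrite permM. Qed.

Lemma central_stab_group_set m R A :
  R \in points_on m -> group_set (central_stab m R A).
Proof.
have im1 X : (1%g : {perm point F}) @: X = X.
  by rewrite -[RHS]imset_id; apply: eq_imset => P; rewrite perm1.
move=> Rm; apply/group_setP; split.
  rewrite inE im1 eqxx andbT; apply/elation_with_centreP.
  by split=> [//|l|P _|l _]; rewrite ?im1 ?perm1 //; exists l; rewrite ?im1.
move=> g h; rewrite !inE => /andP[elg /eqP gA] /andP[elh /eqP hA].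
rewrite imset_permM gA hA eqxx andbT.
have /elation_with_centreP[_ collg fixg Rg] := elg.
have /elation_with_centreP[_ collh fixh Rh] := elh.
apply/elation_with_centreP; split=> // [l|P Pm|l Rl].
- have [l' gl] := collg l; have [l'' hl] := collh l'; exists l''.
  by rewrite imset_permM gl.
- by rewrite permM fixg // fixh.
- by rewrite imset_permM Rg // Rh.
Qed.

End Elations.

(** Point stabilisers are trivial, so every orbit in [X] has [#|G|] elements. *)
Lemma semiregular_dvdn (aT : finGroupType) (rT : finType)
    (to : {action aT &-> rT}) (G : {group aT}) (X : {set rT}) :
    (forall g x, g \in G -> x \in X -> to x g \in X) ->
    (forall g x, g \in G -> x \in X -> to x g = x -> g = 1%g) ->
  #|G| %| #|X|.
Proof.
move=> stabX freeX.
have actX : [acts G, on X | to].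
  apply/subsetP => g Gg; rewrite !inE; apply/subsetP => x Xx.
  by rewrite inE stabX.
rewrite -(acts_sum_card_orbit actX); apply: dvdn_sum => _ /imsetP[x Xx ->].
rewrite -(card_orbit_stab to G x).
suff -> : 'C_G[x | to]%g = 1%g by rewrite cards1 muln1.
apply/trivgP/subsetP => g /setIP[Gg /astab1P gx].
by rewrite inE (freeX g x).
Qed.

(** * Secant counts of a KM-arc and divisibility of the order by its type *)

Section KMArcs.
Variables (F : finFieldType) (t : nat) (A : {set point F}).
Hypotheses (t_ge2 : 2 <= t) (arcA : KM_arc t A).
Implicit Types (P Q R S : point F) (l m : line F).

Definition secants_through i P : {set line F} :=
  [set l in pencil P | secant A i l].
Definition meeting_through P : {set line F} :=
  [set l in pencil P | ~~ secant A 0 l].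

(** One linear formula for the values [0], [2] and [t], ready to be summed over a pencil; when
    [t = 2] the first term vanishes. *)
Lemma card_secant l :
  #|A :&: points_on l| = (t - 2) * secant A t l + 2 * ~~ secant A 0 l.
Proof.
case: arcA => _ /(_ l) + _; rewrite /secant.
case/or3P=> /eqP->; rewrite ?eqxx /=.
- by case: eqVneq; lia.
- by case: eqVneq; lia.
- by case: eqVneq; lia.
Qed.

Lemma count_off_arc P : P \notin A ->
  (t - 2) * #|secants_through t P| + 2 * #|meeting_through P| = #|F| + t.
Proof.
case: (arcA) => cardA _ _ PA; rewrite -cardA -(sum_pencil PA).
rewrite (eq_bigr _ (fun l _ => card_secant l)) big_split -!big_distrr /=.
by congr (_ * _ + _ * _); rewrite -big_mkcondr /= sum1dep_card;
   apply: eq_card => l; rewrite !inE.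
Qed.

(** Each of the [#|F| + 1] lines through [P] has one further arc point, or [t - 1] of them if it is
    a [t]-secant; these add up to [#|F| + t - 1]. *)
Lemma count_on_arc P : P \in A -> 2 < t -> #|secants_through t P| = 1.
Proof.
move=> PA t_gt2; case: (arcA) => cardA _ _.
have count l : l \in pencil P ->
    #|(A :\ P) :&: points_on l| = (t - 2) * secant A t l + 1.
  rewrite inE => Pl; have PAl : P \in A :&: points_on l by rewrite in_setI PA.
  have := card_secant l; rewrite (cardsD1 P) PAl setIDAC.
  suff -> : secant A 0 l = false by rewrite /=; lia.
  by apply/negbTE; rewrite /secant cards_eq0; apply/set0Pn; exists P.
have := cardsD1 P A; rewrite PA cardA => cardAP.
have solve a : (t - 2) * a + #|F|.+1 = #|A :\ P| -> a = 1 by nia.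
apply: solve; rewrite -(sum_pencil (negbT (setD11 _ _))) (eq_bigr _ count).
rewrite big_split -big_distrr /= sum1_card card_pencil; congr (_ * _ + _).
by rewrite -big_mkcondr /= sum1dep_card; apply: eq_card => l; rewrite !inE.
Qed.

(** By [count_on_arc] the [t]-secants partition [A]. *)
Lemma card_t_secants : 2 < t -> t * #|[set l | secant A t l]| = #|F| + t.
Proof.
move=> t_gt2; case: (arcA) => cardA _ _; rewrite -cardA mulnC -sum_nat_const.
have -> : \sum_(l in [set l | secant A t l]) t =
    \sum_(l in [set l | secant A t l]) \sum_(P in A | P \in points_on l) 1.
  apply: eq_bigr => l; rewrite inE => /eqP tl; rewrite sum1_card -[LHS]tl.
  by apply: eq_card => P; rewrite inE [RHS]unfold_in.
rewrite (exchange_big_dep (mem A)) /=; last by move=> ? ? _ /andP[].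
rewrite -[RHS]sum1_card; apply: eq_bigr => P PA.
rewrite -[RHS](count_on_arc PA t_gt2) sum1_card; apply: eq_card => l.
by rewrite [RHS]in_set unfold_in /= PA !inE andbC.
Qed.

Lemma t_dvd_order : 2 < t -> t %| #|F|.
Proof.
move=> /card_t_secants E; rewrite -(dvdn_addl _ (dvdnn t)) -E.
exact: dvdn_mulr.
Qed.

(* For q odd every point off the arc lies on an even number of t-secants, so the
   q / t secants other than l would have to cover the q + 1 - t points of l off
   the arc. *)
Lemma order_even : t < #|F| -> (exists P, P \notin A) -> ~~ odd #|F|.
Proof.
move=> t_ltq [P0 P0A]; have [t_le2|t_gt2] := leqP t 2.
  (* For [t = 2] the count at [P0] reads [2 * b = #|F| + 2]. *)
  have := count_off_arc P0A; have -> : t = 2 by lia.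
  by lia.
apply/negP => odd_q.
have /dvdnP[k qE] := t_dvd_order t_gt2.
have odd_t : odd t by move: odd_q; rewrite qE oddM => /andP[].
case: (arcA) => _ _ /(_ t)[|l tl]; first by rewrite !inE eqxx !orbT.
pose T := [set n | secant A t n] :\ l.
have cardT : #|T| = k.
  have := card_t_secants t_gt2; rewrite (cardsD1 l) inE tl -/T qE.
  by nia.
have cover Q : Q \in points_on l :\: A ->
    exists2 n, n \in T & Q \in points_on n.
  rewrite in_setD => /andP[QA Ql].
  have lQ : l \in secants_through t Q by rewrite inE [_ \in pencil _]inE Ql.
  have odd_D1 : odd #|secants_through t Q :\ l|.
    have := count_off_arc QA; rewrite (cardsD1 l) lQ.
    move/(congr1 odd); rewrite !(oddD, oddM) oddB // odd_t odd_q /=.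
    by case: (odd _).
  have /set0Pn[n] : secants_through t Q :\ l != set0.
    by apply: contraTneq odd_D1 => ->; rewrite cards0.
  rewrite !in_setD1 inE [_ \in pencil _]inE => /and3P[nl Qn tn]; exists n => //.
  by rewrite !inE nl.
have cardD : #|points_on l :\: A| = #|F|.+1 - t.
  have := cardsID A (points_on l); rewrite card_points_on setIC (eqP tl).
  by lia.
(* With [#|F| = k * t] this bound amounts to [(k - 1) * (t - 1) <= 0], but [k] and [t] exceed 1. *)
suff : #|points_on l :\: A| <= #|T| by rewrite cardD cardT; nia.
rewrite -sum1_card -[#|T|]sum1_card.
apply: (@leq_trans
  (\sum_(Q in points_on l :\: A) \sum_(n in T | Q \in points_on n) 1)).
  apply: leq_sum => Q /cover[n nT Qn]; rewrite (bigD1 n) ?nT //=.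
rewrite (exchange_big_dep (mem T)) /=; last by move=> ? ? _ /andP[].
(* A line [n] other than [l] meets [l] once, so it covers at most one of these points. *)
apply: leq_sum => n; rewrite in_setD1 => /andP[neqnl _].
rewrite sum1_card -[leqRHS](card_meet neqnl) setIC; apply: subset_leq_card.
apply/subsetP => Q; rewrite unfold_in /= in_setD.
case/andP=> /andP[_ Ql] /andP[_ Qn].
by apply/setIP.
Qed.

(** A finite field has prime power order, so the even number [#|F|] is a power of 2; its proper
    divisor [t] is a smaller one, and not 1. *)
Lemma double_t_dvd_order : t < #|F| -> (exists P, P \notin A) ->
  ~~ odd t /\ 2 * t %| #|F|.
Proof.
move=> t_ltq offA; have even_q := order_even t_ltq offA.
have t_dvd : t %| #|F|.
  have [t_le2|] := leqP t 2; last exact: t_dvd_order.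
  have -> : t = 2 by lia.
  by rewrite dvdn2.
have [p p_pr charFp] := finPcharP F; have := card_pprimeChar charFp.
set e := logn _ _ => qE; rewrite [#|_|]qE in even_q t_dvd t_ltq *.
have p2 : p = 2.
  move: even_q; rewrite oddX negb_or => /andP[_].
  by have [->//|->] := even_prime p_pr.
subst p; have /(dvdn_pfactor _ _ p_pr)[j j_le tE] := t_dvd.
split; last first.
  by rewrite tE -expnS dvdn_exp2l // -(ltn_exp2l _ _ (isT : 1 < 2)) -tE.
by move: t_ge2; rewrite tE oddX; case: (j).
Qed.

End KMArcs.

(** * Elations with a fixed centre stabilising an arc that misses the axis *)

Section CentralStabiliser.
Variables (F : finFieldType) (t : nat) (A : {set point F}).
Variables (m : line F) (R : point F).
Hypotheses (t_ge2 : 2 <= t) (arcA : KM_arc t A) (mA0 : secant A 0 m).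
Hypothesis Rm : R \in points_on m.
Implicit Types (P Q S : point F) (l : line F).

Lemma external_notin P : P \in points_on m -> P \notin A.
Proof.
move=> Pm; apply/negP => PA; move: mA0; rewrite /secant cards_eq0.
by apply/negP/set0Pn; exists P; rewrite in_setI PA.
Qed.

Canonical central_stab_group := group (central_stab_group_set A Rm).

Lemma central_stab_arc g : g \in central_stab m R A ->
  elation_with_centre m R g /\ g @: A = A.
Proof. by rewrite inE => /andP[? /eqP]. Qed.

Lemma card_imset_secant (g : {perm point F}) l : g @: A = A ->
  #|A :&: g @: points_on l| = #|A :&: points_on l|.
Proof.
move=> gA; rewrite -{1}gA -imsetI; last by move=> ? ? _ _ /perm_inj.
by rewrite card_imset //; exact: perm_inj.
Qed.

(* [~~ p 0] excludes the axis, the only line through [S] the group can fix. *)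
Lemma central_stab_dvd_lines S (p : pred nat) : S \in points_on m -> S != R ->
  ~~ p 0 ->
  #|central_stab m R A| %| #|[set l in pencil S | p #|A :&: points_on l|]|.
Proof.
(* Lines are replaced by their point sets, so that the setwise action applies. *)
move=> Sm neqSR p0; rewrite -(card_imset _ (@points_on_inj F)).
apply: (@semiregular_dvdn _ _ ('P^*)%act central_stab_group).
  move=> g _ /central_stab_arc[el gA] /imsetP[l + ->].
  rewrite inE [l \in pencil S]inE => /andP[Sl pl].
  have /elation_with_centreP[_ coll fixm _] := el; have [l' gl] := coll l.
  apply/imsetP; exists l'; last by rewrite -gl.
  rewrite inE [l' \in pencil S]inE -gl -(fixm S Sm) imset_f //=.
  by rewrite card_imset_secant.
move=> g _ /central_stab_arc[el gA] /imsetP[l + ->] gl.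
rewrite inE [l \in pencil S]inE => /andP[Sl pl].
apply: (elation_fix_line el Sm neqSR Sl _ gl).
by apply: contraNneq p0 => lm; move: pl; rewrite lm (eqP mA0).
Qed.

(** The contradiction for both types: order [t] would force [2 * t] to divide [#|F| + t]. *)
Lemma central_stab_order_neq : t < #|F| -> #|central_stab m R A| != t.
Proof.
move=> t_ltq.
have offA : exists P, P \notin A by exists R; apply: external_notin.
have [even_t t2_dvd] := double_t_dvd_order t_ge2 arcA t_ltq offA.
have [S Sm neqSR] : exists2 S, S \in points_on m & S != R.
  have /subsetPn[S Sm SR] : ~~ (points_on m \subset [set R]).
    apply/negP => /subset_leq_card; rewrite card_points_on cards1.
    by have := card_field_gt1 F; lia.
  by exists S; rewrite // -in_set1.
apply/eqP => ordH.
have := count_off_arc t_ge2 arcA (external_notin Sm).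
have /dvdnP[b ->] : t %| #|meeting_through A S|.
  rewrite -{1}ordH.
  exact: (@central_stab_dvd_lines S (fun i => i != 0) Sm neqSR isT).
have : 2 < t -> t %| #|secants_through A t S|.
  move=> t_gt2; rewrite -{1}ordH.
  apply: (@central_stab_dvd_lines S (fun i => i == t) Sm neqSR).
  by rewrite eq_sym -lt0n; lia.
case/dvdnP: t2_dvd => k ->.
have [t_le2 _|t_gt2 /(_ isT)/dvdnP[c ->]] := leqP t 2.
  (* Here the count reads [4 * b = 4 * k + 2]. *)
  have -> : t = 2 by lia.
  by rewrite subnn; lia.
have -> : (t - 2) * (c * t) = (t - 2) * c * t by lia.
have -> : 2 * (b * t) = 2 * b * t by lia.
have -> : k * (2 * t) + t = (k * 2).+1 * t by lia.
(* Cancelling [t] leaves [(t - 2) * c + 2 * b = 2 * k + 1], whose sides differ in parity as [t] is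
   even. *)
rewrite -mulnDl => /eqP; rewrite eqn_pmul2r; last lia.
move=> /eqP/(congr1 odd); rewrite /= !(oddD, oddM) oddB // (negPf even_t) /=.
by rewrite andbF.
Qed.

Lemma central_stab_free g P :
  g \in central_stab m R A -> P \notin points_on m -> g P = P -> g = 1%g.
Proof. by move=> /central_stab_arc[el _]; exact: (elation_fix_off_axis el). Qed.

Lemma central_stab_orbit_line g l P : g \in central_stab m R A ->
  R \in points_on l -> P \in A :&: points_on l -> g P \in A :&: points_on l.
Proof.
move=> /central_stab_arc[/elation_with_centreP[_ _ _ fixR] gA] Rl.
by rewrite !in_setI => /andP[PA Pl]; rewrite -{1}gA -(fixR l Rl) !imset_f.
Qed.

(** An elation from [trans] moving [P] to another point of [l] has an a priori unknown centre [R'].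
    It stabilises the line [PR'], which contains [P] and its image and so is [l]; hence [R'] is [R],
    the point of [l] on [m]. The stabiliser is thus regular on the arc points of [l]. *)
Lemma central_stab_orderE l P : P \in A :&: points_on l -> R \in points_on l -> 
  l != m ->
  {in A :&: points_on l, forall Q,
    exists2 g, g \in elation_stab m A & g P = Q} ->
  #|central_stab m R A| = #|A :&: points_on l|.
Proof.
move=> PAl Rl neqlm trans.
have [PA Pl] : P \in A /\ P \in points_on l by apply/andP; rewrite -in_setI.
have offm Q : Q \in A -> Q \notin points_on m.
  by move=> QA; apply: contraTN QA; exact: external_notin.
have -> : A :&: points_on l =
    [set g P | g : {perm point F} in central_stab_group].
  apply/setP => Q; apply/idP/imsetP => [QAl|[g Hg ->]]; last first.
    exact: central_stab_orbit_line.
  have [QA Ql] : Q \in A /\ Q \in points_on l by apply/andP; rewrite -in_setI.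
  have [neqPQ|neqPQ] := eqVneq P Q; first by exists 1%g; rewrite ?group1 ?perm1.
  have [g + gP] := trans Q QAl.
  rewrite 2!inE => /andP[/existsP[R' el] gA]; exists g => //.
  rewrite inE gA andbT; suff -> : R = R' by [].
  have /elation_with_centreP[R'm _ _ fixR'] := el.
  have neqPR' : P != R' by apply: contraNneq (offm P PA) => ->.
  have [k Pk R'k] := join_exists neqPR'.
  have kl : k = l.
    by apply: (join_unique neqPQ) => //; rewrite -gP -(fixR' k R'k) imset_f.
  by apply: (meet_unique neqlm) => //; rewrite -kl.
rewrite card_in_imset // => g h Hg Hh ghP.
apply: (mulIg h^-1%g); rewrite mulgV; apply: (central_stab_free _ (offm P PA)).
  by apply: (@groupM _ central_stab_group) => //; apply: groupVr.
by rewrite permM ghP permK.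
Qed.

(** Only the identity fixes any of the [#|F|] points other than [R] on a line through [R] distinct
    from the axis. *)
Lemma central_stab_dvd_order : #|central_stab m R A| %| #|F|.
Proof.
have [P Pm] := missing_point m.
have neqPR : P != R by apply: contraNneq Pm => ->.
have [l Pl Rl] := join_exists neqPR.
have -> : #|F| = #|points_on l :\ R|.
  by have := cardsD1 R (points_on l); rewrite Rl card_points_on => -[].
have offm Q : Q \in points_on l :\ R -> Q \notin points_on m.
  rewrite in_setD1 => /andP[neqQR Ql]; apply: contraNN Pm => Qm.
  by rewrite -(join_unique neqQR Ql Rl Qm Rm).
apply: (@semiregular_dvdn _ _ 'P%act central_stab_group) => [g Q Hg QlR|g Q Hg].
  have /central_stab_arc[/elation_with_centreP[_ _ fixm fixR] _] := Hg.
  move: (QlR); rewrite !in_setD1 /= apermE => /andP[neqQR Ql].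
  by rewrite -(fixR l Rl) imset_f // -(fixm R Rm) (inj_eq perm_inj) neqQR.
by move=> /offm Qm; apply: central_stab_free.
Qed.

Lemma central_stab_dvd_arc : #|central_stab m R A| %| #|A|.
Proof.
apply: (@semiregular_dvdn _ _ 'P%act central_stab_group) => g Q Hg QA.
  by have /central_stab_arc[_ <-] := Hg; rewrite /= apermE imset_f.
apply: central_stab_free => //; apply: contraTN QA; exact: external_notin.
Qed.

End CentralStabiliser.

(** * Reduction of both types to a stabiliser of order [t] *)

Theorem theorem1p4 (F : finFieldType) (t : nat) (A : {set point F})
    (m : line F) :
  2 <= t < #|F| -> elation_KM_arc t A m -> secant A t m.
Proof.
case/andP=> t_ge2 t_ltq [arcA elA]; apply/negPn/negP => mAt.
have [_ sec _] := arcA.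
case: elA => [[t2 [g + g1]]|[t_gt2 trans]].
  rewrite 2!inE => /andP[/existsP[R el] gA].
  have /elation_with_centreP[Rm _ _ _] := el.
  have mA0 : secant A 0 m by move: (sec m) mAt; rewrite t2 orbb => /orP[]// ->.
  have H_g : g \in central_stab m R A by rewrite inE el.
  have := central_stab_order_neq t_ge2 arcA mA0 Rm t_ltq.
  have dvd_q := central_stab_dvd_order A Rm.
  have := central_stab_dvd_arc mA0 Rm; have [-> _ _] := arcA.
  (* The order divides [#|F|] and [#|F| + 2], hence 2; it is not 1 because [g] is a non-trivial
     element. *)
  rewrite (dvdn_addr _ dvd_q) t2 => dvd2 /negP; apply.
  apply/eqP/prime_nt_dvdP => //.
  apply: contraNneq g1 => /card1_trivg H1.
  move: H_g; rewrite -[central_stab m R A]/(gval (central_stab_group A Rm)).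
  by rewrite H1 inE.
have mA0 : secant A 0 m.
  (* If [m] were a 2-secant, a point [P] of [A] on it would be on a [t]-secant [l] other than [m];
     some elation with axis [m] would move [P] along [l], though it fixes every point of [m]. *)
  have /or3P[//|mA2|] := sec m; last by rewrite (negPf mAt).
  have /card_gt0P[P /setIP[PA Pm]] : 0 < #|A :&: points_on m|.
    by rewrite (eqP mA2).
  have := count_on_arc t_ge2 arcA PA t_gt2.
  move/eqP/cards1P=> [l /setP/(_ l)]; rewrite set11 2!inE => /andP[Pl tl].
  have lm : l != m by apply: contraNneq mAt => <-.
  have : ~~ (A :&: points_on l \subset [set P]).
    apply/negP => /subset_leq_card; rewrite (eqP tl) cards1; lia.
  case/subsetPn => Q QAl; rewrite in_set1 => /eqP[].
  have PAl : P \in A :&: points_on l by rewrite in_setI PA.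
  have [g + <-] := trans l tl lm P Q PAl QAl.
  rewrite 2!inE => /andP[/existsP[R /elation_with_centreP[_ _ fixm _]] _].
  exact: fixm.
(* Any [t]-secant [l] will do: with its intersection with [m] as centre [R], the stabiliser has
   order [t]. *)
have [_ _ /(_ t)[|l tl]] := arcA; first by rewrite !inE eqxx !orbT.
have lm : l != m by apply: contraNneq mAt => <-.
have [R Rl Rm] := meet_exists l m.
have /card_gt0P[P PAl] : 0 < #|A :&: points_on l| by rewrite (eqP tl); lia.
have := central_stab_order_neq t_ge2 arcA mA0 Rm t_ltq.
rewrite (central_stab_orderE mA0 Rm PAl Rl lm) ?(eqP tl) ?eqxx // => Q QAl.
exact: (trans l tl lm P Q PAl QAl).
Qed.
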